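(* Let $\Phi \subseteq 2^E$ be an interval with vertex $e \in E$. If $\Phi$ satisfies the spectral recursion with respect to $e$, then so does its dual $\Phi^* = \{E \setminus F : F \in \Phi\}$.
   Context: $E$ is a finite set and $2^E$ its Boolean algebra of subsets. A set $\Phi \subseteq 2^E$ is an interval if $F \subseteq G \subseteq H$ and $F,H \in \Phi$ imply $G \in \Phi$. Elements of the ground set $E$ are the vertices of $\Phi$ (a vertex need not lie in any face); members of $\Phi$ are its faces; $\dim F = |F|-1$. $\Phi_i$ is the set of $i$-dimensional faces, $i \ge -1$. The dual of an interval in $2^E$ is again an interval in $2^E$. For $e \in E$: the deletion is $\Phi - e = \{F \in \Phi : e \notin F\}$, the contraction is $\Phi/e = \{F \setminus \{e\} : F \in \Phi,\ e \in F\}$, the star is $\mathrm{st}_\Phi e = \bigcup \{F, F \cup \{e\}\}$ over all $F$ with $e \notin F$ and $F, F\cup\{e\} \in \Phi$, and the reduction is $\Phi \| e = \Phi \setminus \mathrm{st}_\Phi e$. Each of $\Phi-e$, $\Phi/e$, $\Phi\|e$ is again an interval in $2^E$. Fix a total order on $E$. $C_i(\Phi;\mathbb{R})$ is the real vector space with basis $\Phi_i$; the boundary operator $\partial_i : C_i \to C_{i-1}$ sends $F = \{v_0 < \cdots < v_i\}$ to $\sum_j (-1)^j (F \setminus \{v_j\})$, the sum over those $j$ with $F\setminus\{v_j\} \in \Phi$. Let $\partial_i^*$ be its adjoint (transpose in these bases). The Laplacian is $L_i(\Phi) = \partial_{i+1}\partial_{i+1}^* + \partial_i^*\partial_i$ on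 $C_i(\Phi;\mathbb{R})$; its eigenvalues are non-negative reals and do not depend on the vertex order. $\mathbf{s}_i(\Phi)$ is the multiset of eigenvalues of $L_i(\Phi)$. The spectrum polynomial is the formal generating function $S_\Phi(t,q) = \sum_{i \ge 0} t^i \sum_{\lambda \in \mathbf{s}_{i-1}(\Phi)} q^\lambda$ (formal sums of $q^\lambda$ with real exponents $\lambda \ge 0$). $\Phi$ satisfies the spectral recursion with respect to $e$ if $e$ is a vertex of $\Phi$ and $S_\Phi(t,q) = q\,S_{\Phi-e}(t,q) + qt\,S_{\Phi/e}(t,q) + (1-q)\,S_{\Phi\|e}(t,q)$. *)

(* Defs.v *)
From HB Require Import structures.
From mathcomp Require Import all_boot all_order all_algebra.
From mathcomp Require Import polyrcf.
From mathcomp Require Import monalg.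
From mathcomp Require Import reals.

Set Implicit Arguments.
Unset Strict Implicit.
Unset Printing Implicit Defensive.

Import Order.TTheory GRing.Theory Num.Theory.
Local Open Scope ring_scope.

Section Intervals.
Variable E : finType.
Implicit Types (Phi : {set {set E}}) (e : E).

Definition is_interval Phi : Prop :=
  forall F G H : {set E},
    F \in Phi -> H \in Phi -> F \subset G -> G \subset H -> G \in Phi.

Definition dual Phi : {set {set E}} := [set ~: F | F : {set E} in Phi].

Definition deletion Phi e : {set {set E}} := [set F in Phi | e \notin F].

Definition contraction Phi e : {set {set E}} :=
  [set F :\ e | F : {set E} in Phi & e \in F].

Definition star Phi e : {set {set E}} :=
  \bigcup_(F in Phi | (e \notin F) && (e |: F \in Phi)) [set F; e |: F].

Definition reduction Phi e : {set {set E}} := Phi :\: star Phi e.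

(* An integer: the empty face has dimension -1. *)
Definition dim (F : {set E}) : int := #|F|%:Z - 1.

Definition faces Phi (i : int) : {set {set E}} := [set F in Phi | dim F == i].

End Intervals.

Section Laplacian.
Variables (R : rcfType) (d : Order.disp_t) (E : finOrderType d).
Implicit Types (Phi : {set {set E}}) (i j : int).

(* The coefficient of G in \sum_j (-1)^j (F \ {v_j}), F = {v_0 < ... < v_i}:
   the position of v in F is the number of elements of F below v. *)
Definition incidence (F G : {set E}) : R :=
  \sum_(v in F | F :\ v == G) (-1) ^+ #|[set w in F | (w < v)%O]|.

(* The block C_i -> C_j of the boundary operator on the sum of all the C_k,
   acting on column vectors in the bases of faces: it is the matrix of
   \partial_i for j = i - 1.  The target dimension is a separate argument so
   that \partial_(i+1) takes its values in C_i and not in C_(i + 1 - 1). *)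
Definition boundary Phi j i : 'M[R]_(#|faces Phi j|, #|faces Phi i|) :=
  \matrix_(g, f) incidence (enum_val f) (enum_val g).

Definition laplacian Phi i : 'M[R]_#|faces Phi i| :=
  boundary Phi i (i + 1) *m (boundary Phi i (i + 1))^T
  + (boundary Phi (i - 1) i)^T *m boundary Phi (i - 1) i.

(* The eigenvalues of L_i, each repeated according to its multiplicity. *)
Definition spectrum Phi i : seq R :=
  let p := char_poly (laplacian Phi i) in
  flatten [seq nseq (mup x p) x | x <- rootsR p].

Lemma gram_ge0 m n (v : 'rV[R]_m) (A : 'M[R]_(m, n)) :
  0 <= (v *m (A *m A^T) *m v^T) 0 0.
Proof.
rewrite mulmxA -mulmxA -trmx_mul mxE sumr_ge0 // => k _.
by rewrite [_^T _ _]mxE -expr2 sqr_ge0.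
Qed.

Lemma spectrum_ge0 Phi i (x : R) : x \in spectrum Phi i -> 0 <= x.
Proof.
case/flattenP=> s /mapP[y yroot ->]; rewrite mem_nseq => /andP[_ /eqP ->].
have pN0 : char_poly (laplacian Phi i) != 0.
  exact/monic_neq0/char_poly_monic.
have := roots_on_rootsR pN0 y; rewrite yroot in_itv /= => /idP.
rewrite -eigenvalue_root_char => /eigenvalueP[v vL vN0].
have vv : 0 < (v *m v^T) 0 0.
  have /rV0Pn[k vk] := vN0.
  rewrite mxE (bigD1 k) //= ltr_wpDr ?sumr_ge0 // => [l _|].
    by rewrite mxE -expr2 sqr_ge0.
  by rewrite mxE -expr2 exprn_even_gt0.
have : 0 <= (v *m laplacian Phi i *m v^T) 0 0.
  rewrite /laplacian mulmxDr mulmxDl mxE addr_ge0 ?gram_ge0 //.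
  by rewrite -{2}[boundary Phi (i - 1) i]trmxK gram_ge0.
by rewrite vL -scalemxAl mxE pmulr_lge0.
Qed.

End Laplacian.

Section Exponents.
Variable R : rcfType.

Record exponent := Exponent { exponent_val :> R; _ : 0 <= exponent_val }.

HB.instance Definition _ := [isSub for exponent_val].
HB.instance Definition _ := [Choice of exponent by <:].

Definition exponent0 : exponent := Exponent (lexx 0).
Definition exponentD (x y : exponent) : exponent :=
  Exponent (addr_ge0 (valP x) (valP y)).

Lemma exponentDA : associative exponentD.
Proof. by move=> x y z; apply/val_inj/addrA. Qed.

Lemma exponentDC : commutative exponentD.
Proof. by move=> x y; apply/val_inj/addrC. Qed.

Lemma exponent0D : left_id exponent0 exponentD.
Proof. by move=> x; apply/val_inj/add0r. Qed.

Lemma exponentD0 : right_id exponent0 exponentD.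
Proof. by move=> x; apply/val_inj/addr0. Qed.

Lemma exponentD_eq0 x y :
  exponentD x y = exponent0 -> x = exponent0 /\ y = exponent0.
Proof.
move=> /(congr1 val) /eqP /=; rewrite paddr_eq0 ?(valP x) ?(valP y) //.
by case/andP=> /eqP x0 /eqP y0; split; apply/val_inj.
Qed.

HB.instance Definition _ := Choice_isMonomialDef.Build exponent
  exponentDA exponent0D exponentD0 exponentD_eq0.
HB.instance Definition _ :=
  MonomialDef_isConomialDef.Build exponent exponentDC.

(* Integral formal sums of the q^x, x >= 0 real, with q^x q^y = q^(x + y). *)
Definition qsums := {malg int[exponent]}.
HB.instance Definition _ := GRing.ComRing.on qsums.

(* Only meaningful for 0 <= x, which spectrum_ge0 guarantees below. *)
Definition qpow (x : R) : qsums := << insubd exponent0 x >>.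

End Exponents.

Section SpectralRecursion.
Variables (R : rcfType) (d : Order.disp_t) (E : finOrderType d).
Implicit Types (Phi : {set {set E}}) (e : E).

(* The indeterminate 'X is t.  The terms with i > #|E| vanish, as there are no
   faces of dimension #|E| or more. *)
Definition spectrum_poly Phi : {poly qsums R} :=
  \sum_(i < #|E|.+1)
    'X^i * (\sum_(x <- spectrum R Phi (i%:Z - 1)) qpow x)%:P.

(* Every element of the ground set E is a vertex, so e : E is all that is
   needed for e to be a vertex of Phi. *)
Definition spectral_recursion Phi e : Prop :=
  let q : {poly qsums R} := (qpow 1)%:P in
  let t : {poly qsums R} := 'X in
  spectrum_poly Phi =
    q * spectrum_poly (deletion Phi e)
    + q * t * spectrum_poly (contraction Phi e)
    + (1 - q) * spectrum_poly (reduction Phi e).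

End SpectralRecursion.

(* Main.v *)
(* Complementation in a ground set V turns the boundary operator of Phi into its
   transpose up to a sign.  Removing v from F contributes the position of v in F
   to the sign, the dual step contributes the position of v in V minus that
   position, so the two signs differ by (-1)^(position of v in V), which is the
   coboundary of F |-> \prod_(w in F) (-1)^(position of w in V).  Hence the
   Laplacians of Phi and of its dual in V are conjugate in dimensions adding up
   to #|V| - 2.  Since (Phi^* - e) and (Phi^* / e) are the duals in E \ e of
   Phi / e and Phi - e, and Phi^* || e is the dual of Phi || e, reversing the
   order of the coefficients of the recursion for Phi gives that for Phi^*. *)
Require Import Defs.
From mathcomp Require Import all_boot all_order all_algebra.
From mathcomp Require Import polyrcf zify ring.
From mathcomp Require Import reals.

Set Implicit Arguments.
Unset Strict Implicit.
Unset Printing Implicit Defensive.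

Import Order.TTheory GRing.Theory Num.Theory.
Local Open Scope ring_scope.

(** * Complements of set families and the vertex operations *)

Definition relative_dual (E : finType) (V : {set E}) (Phi : {set {set E}}) :
  {set {set E}} := [set V :\: F | F : {set E} in Phi].

Section SetIdentities.
Variables (E : finType).
Implicit Types (Phi : {set {set E}}) (F V : {set E}) (e : E).

(** Complementation in [V] is an involution on subsets of [V], hence the assumption on [Phi]. *)
Lemma mem_relative_dual V Phi F : Phi \subset powerset V ->
  (F \in relative_dual V Phi) = (F \subset V) && (V :\: F \in Phi).
Proof.
move=> /subsetP PhiV; apply/imsetP/andP => [[G GPhi ->]|[FV VFPhi]].
  rewrite subsetDl setDDr setDv set0U; split=> //.
  by rewrite (setIidPr _) // -powersetE PhiV.
by exists (V :\: F) => //; rewrite setDDr setDv set0U (setIidPr FV).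
Qed.

Lemma dualE Phi : dual Phi = relative_dual setT Phi.
Proof. by apply: eq_imset => F; rewrite setTD. Qed.

Lemma sub_powersetT Phi : Phi \subset powerset setT.
Proof. by rewrite powersetT subsetT. Qed.

Lemma mem_dual Phi F : (F \in dual Phi) = (~: F \in Phi).
Proof. by rewrite dualE mem_relative_dual ?sub_powersetT // subsetT setTD. Qed.

Lemma mem_contraction Phi e F :
  (F \in contraction Phi e) = (e \notin F) && (e |: F \in Phi).
Proof.
apply/imsetP/andP => [[G]|[eF eFPhi]].
  by rewrite inE => /andP[GPhi eG] ->; rewrite setD11 setD1K.
by exists (e |: F); rewrite ?setU1K // inE eFPhi setU11.
Qed.

Lemma setD1_notin F e : e \notin F -> F :\ e = F.
Proof. by move=> eF; apply/setDidPl; rewrite disjoint_sym disjoints1. Qed.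

(** Complementation exchanges the two conditions, which makes the star, and with it the reduction,
    compatible with duality. *)
Lemma mem_star Phi e F :
  (F \in star Phi e) = (F :\ e \in Phi) && (e |: F \in Phi).
Proof.
apply/bigcupP/andP => [[G /andP[GPhi /andP[eG eGPhi]]]|[F1 F2]].
  rewrite !inE => /orP[] /eqP ->; first by rewrite (setD1_notin eG).
  by rewrite setU1K // setUA setUid.
exists (F :\ e).
  rewrite F1 setD11 /=; congr (is_true (_ \in Phi)): F2.
  by apply/setP=> x; rewrite !inE; case: eqP.
have [eF|eF] := boolP (e \in F); first by rewrite setD1K // set22.
by rewrite (setD1_notin eF) set21.
Qed.

Lemma deletion_sub Phi e : deletion Phi e \subset powerset ([set: E] :\ e).
Proof.
by apply/subsetP=> F; rewrite inE powersetE subsetD1 subsetT => /andP[].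
Qed.

Lemma contraction_sub Phi e : contraction Phi e \subset powerset ([set: E] :\ e).
Proof.
by apply/subsetP=> F; rewrite mem_contraction powersetE subsetD1 subsetT => /andP[].
Qed.

Lemma deletion_dual Phi e :
  deletion (dual Phi) e = relative_dual ([set: E] :\ e) (contraction Phi e).
Proof.
apply/setP=> F; rewrite (mem_relative_dual _ (@contraction_sub Phi e)).
rewrite !inE mem_dual mem_contraction subsetD1 subsetT !inE eqxx /= andbF /= andbC.
case: (boolP (e \in F)) => //= eF; congr (_ \in Phi).
apply/setP=> x; rewrite !inE andbT.
by have [->|] := eqVneq x e; rewrite ?(negbTE eF) ?andbT.
Qed.

Lemma contraction_dual Phi e :
  contraction (dual Phi) e = relative_dual ([set: E] :\ e) (deletion Phi e).
Proof.
apply/setP=> F; rewrite (mem_relative_dual _ (@deletion_sub Phi e)).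
rewrite mem_contraction mem_dual subsetD1 subsetT !inE eqxx /= andbF andbT.
by congr (_ && (_ \in Phi)); apply/setP=> x; rewrite !inE andbT negb_or andbC.
Qed.

Lemma card_setTD1 e : #|[set: E] :\ e|%:Z = #|E|%:Z - 1.
Proof. by rewrite -cardsT (cardsD1 e [set: E]) in_setT PoszD addrAC subrr add0r. Qed.

Lemma reduction_dual Phi e : reduction (dual Phi) e = dual (reduction Phi e).
Proof.
apply/setP=> F; rewrite mem_dual !in_setD !mem_star !mem_dual andbC.
rewrite [RHS]andbC; congr (_ && ~~ _); rewrite andbC.
by congr (_ && _); congr (_ \in Phi); apply/setP=> x; rewrite !inE ?negb_or ?negb_and ?negbK.
Qed.

(** The 2 collects the shift by 1 between cardinality and dimension, once for each of the two
    faces. *)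
Lemma dim_setD V F : F \subset V -> Defs.dim (V :\: F) = #|V|%:Z - 2 - Defs.dim F.
Proof.
move=> FV; rewrite /Defs.dim cardsD (setIidPr FV) -subzn ?subset_leq_card //; ring.
Qed.

Lemma faces_relative_dual V Phi i F : Phi \subset powerset V ->
  (F \in faces (relative_dual V Phi) i)
  = (F \subset V) && (V :\: F \in faces Phi (#|V|%:Z - 2 - i)).
Proof.
move=> PhiV; rewrite !inE mem_relative_dual // -andbA.
have [FV|//] := boolP (F \subset V); rewrite dim_setD //=; congr (_ && _).
by rewrite (inj_eq (addrI _)) eqr_opp.
Qed.

End SetIdentities.

(** * Orthogonal conjugacy of Laplacians under duality *)

(** The equality of [m] and [n] is a hypothesis because the face counts it is applied to are only
    provably equal. *)
Lemma char_poly_orthogonal_conj (R : comNzRingType) m n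
    (P : 'M[R]_(m, n)) (A : 'M[R]_n) : m = n -> P *m P^T = 1%:M ->
  char_poly (P *m A *m P^T) = char_poly A.
Proof.
move=> mn; subst m => PP; rewrite /char_poly.
pose Q := map_mx polyC P.
have QQ : Q *m Q^T = 1%:M by rewrite map_trmx -map_mxM PP map_mx1.
have -> : char_poly_mx (P *m A *m P^T) = Q *m char_poly_mx A *m Q^T.
  rewrite /char_poly_mx mulmxBr mulmxBl mul_mx_scalar -scalemxAl QQ.
  by rewrite scalemx1 !map_mxM -map_trmx.
by rewrite !det_mulmx mulrAC -det_mulmx QQ det1 mul1r.
Qed.

Section DualLaplacian.
Variables (R : rcfType) (d : Order.disp_t) (E : finOrderType d).
Variables (V : {set E}) (Phi : {set {set E}}).
Implicit Types (F G : {set E}) (i j : int).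
Hypothesis PhiV : Phi \subset powerset V.

Definition below_sign (v : E) : R := (-1) ^+ #|[set w in V | (w < v)%O]|.
Definition face_sign (F : {set E}) : R := \prod_(w in F) below_sign w.

Lemma face_sign_sqr F : face_sign F * face_sign F = 1.
Proof.
rewrite -big_split big1 // => v _ /=.
by rewrite -expr2 sqrr_sign.
Qed.

(** If [F = v |: G] with [v] outside [G], then [V :\: F] arises from [V :\: G] by removing the same
    [v]; otherwise both incidences are 0. *)
Lemma incidence_setD F G : F \subset V -> G \subset V ->
  incidence R (V :\: G) (V :\: F)
  = face_sign G * incidence R F G * face_sign F.
Proof.
move=> FV GV; rewrite /incidence mulr_sumr mulr_suml.
have indexE v : (v \in V :\: G) && ((V :\: G) :\ v == V :\: F)
           = (v \in F) && (F :\ v == G).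
  apply/andP/andP => [[]|[vF /eqP <-]].
    rewrite inE => /andP[vG vV] /eqP eF.
    have FE : F = v |: G.
      apply/setP=> x; have /setP/(_ x) := eF; rewrite !inE.
      have [->|_] := eqVneq x v; first by rewrite vV andbT; case: (v \in F).
      have := subsetP FV x; have := subsetP GV x.
      by case: (x \in V) (x \in F) (x \in G) => [] [] [] //= GV' FV';
        move: (GV' isT) || move: (FV' isT).
    by rewrite FE setU11 setU1K.
  have vV := subsetP FV _ vF.
  rewrite !inE eqxx vV; split=> //; apply/eqP/setP=> x; rewrite !inE.
  by case: eqP => //= ->; rewrite vF.
rewrite (eq_bigl _ _ indexE); apply: eq_bigr => v /andP[vF /eqP GE].
have vG : v \notin G by rewrite -GE setD11.
have FE : F = v |: G by rewrite -GE setD1K.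
rewrite mulrC mulrA.
(* Since [face_sign F] is [below_sign v * face_sign G], the two face signs multiply to
   [below_sign v]. *)
rewrite {1}FE {1}/face_sign big_setU1 //= -/(face_sign G).
rewrite -[below_sign v * _ * _]mulrA face_sign_sqr mulr1 /below_sign.
have <- : [set w in G | (w < v)%O] = [set w in F | (w < v)%O].
  by apply/setP=> w; rewrite FE !inE; case: eqP => // ->; rewrite ltxx !andbF.
(* Only parities matter: the elements of [V] below [v] split into those in [G] and those outside,
   and the former are counted twice. *)
rewrite -exprD -signr_odd -[in RHS]signr_odd; congr (_ ^+ nat_of_bool _).
rewrite -(cardsID G [set w in V | (w < v)%O]).
have -> : [set w in V | (w < v)%O] :&: G = [set w in G | (w < v)%O].
  apply/setP=> w; rewrite !inE; have := subsetP GV w.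
  by case: (w \in G) => [-> //|_]; rewrite ?andbT ?andbF.
have -> : [set w in V | (w < v)%O] :\: G = [set w in V :\: G | (w < v)%O].
  by apply/setP=> w; rewrite !inE andbA.
by rewrite !oddD addbAC addbb.
Qed.

Lemma card_faces_relative_dual i :
  #|faces (relative_dual V Phi) i| = #|faces Phi (#|V|%:Z - 2 - i)|.
Proof.
have <- : [set V :\: F | F in faces (relative_dual V Phi) i]
          = faces Phi (#|V|%:Z - 2 - i).
  apply/setP=> F; apply/imsetP/idP => [[G]|FP].
    by rewrite faces_relative_dual // => /andP[_ GP ->].
  have FV : F \subset V.
    by move: FP; rewrite inE -powersetE => /andP[/(subsetP PhiV)].
  have VVF : V :\: (V :\: F) = F by rewrite setDDr setDv set0U (setIidPr FV).
  by exists (V :\: F); rewrite // faces_relative_dual // subsetDl VVF.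
rewrite card_in_imset // => F G; rewrite !faces_relative_dual //.
move=> /andP[FV _] /andP[GV _] /(congr1 (setD V)).
by rewrite !setDDr !setDv !set0U (setIidPr FV) (setIidPr GV).
Qed.

Lemma setD_in_faces i (f : 'I_#|faces (relative_dual V Phi) i|) :
  V :\: enum_val f \in faces Phi (#|V|%:Z - 2 - i).
Proof. by have := enum_valP f; rewrite faces_relative_dual // => /andP[]. Qed.

Definition dual_ord i (f : 'I_#|faces (relative_dual V Phi) i|) :
    'I_#|faces Phi (#|V|%:Z - 2 - i)| :=
  enum_rank_in (setD_in_faces f) (V :\: enum_val f).

Lemma enum_val_dual_ord i (f : 'I_#|faces (relative_dual V Phi) i|) :
  enum_val (dual_ord f) = V :\: enum_val f.
Proof. by rewrite enum_rankK_in ?setD_in_faces. Qed.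

Lemma dual_ord_inj i : injective (@dual_ord i).
Proof.
move=> f g /(congr1 enum_val); rewrite !enum_val_dual_ord => /(congr1 (setD V)).
have fV := enum_valP f; have gV := enum_valP g.
rewrite !faces_relative_dual // in fV gV.
case/andP: fV => fV _; case/andP: gV => gV _.
rewrite !setDDr !setDv !set0U (setIidPr fV) (setIidPr gV).
exact: enum_val_inj.
Qed.

(** A signed permutation matrix, hence orthogonal; the sign is read off the face of [Phi]. *)
Definition dual_mx i :
    'M[R]_(#|faces (relative_dual V Phi) i|, #|faces Phi (#|V|%:Z - 2 - i)|) :=
  \matrix_(f, g) (face_sign (enum_val g) *+ (g == dual_ord f)).

Lemma mul_dual_mx i n (A : 'M[R]_(_, n)) f k :
  (dual_mx i *m A) f k = face_sign (V :\: enum_val f) * A (dual_ord f) k.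
Proof.
rewrite mxE (bigD1 (dual_ord f)) //= mxE eqxx enum_val_dual_ord big1 ?addr0 //.
by move=> g /negbTE gf; rewrite mxE gf mul0r.
Qed.

Lemma mul_tr_dual_mx i n (A : 'M[R]_(n, _)) f k :
  (A *m (dual_mx i)^T) k f = A k (dual_ord f) * face_sign (V :\: enum_val f).
Proof.
by rewrite -[A]trmxK -trmx_mul mxE mul_dual_mx mulrC [in RHS]mxE.
Qed.

Lemma dual_mx_trK i : dual_mx i *m (dual_mx i)^T = 1%:M.
Proof.
apply/matrixP=> f g; rewrite mul_tr_dual_mx !mxE enum_val_dual_ord.
rewrite (inj_eq (@dual_ord_inj i)).
by rewrite eq_sym; have [_|_] := eqVneq f g; rewrite ?face_sign_sqr ?mul0r.
Qed.

Lemma tr_dual_mxK i : (dual_mx i)^T *m dual_mx i = 1%:M.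
Proof.
(* Swapping the factors needs a square matrix, so the equal face counts are first identified in its
   type. *)
move: (dual_mx i) (dual_mx_trK i); rewrite card_faces_relative_dual => P.
exact: mulmx1C.
Qed.

(** Complementation reverses inclusion, hence the transpose; entrywise this is [incidence_setD] for
    the complements. *)
Lemma boundary_relative_dual i j :
  boundary R (relative_dual V Phi) j i
  = dual_mx j *m (boundary R Phi (#|V|%:Z - 2 - i) (#|V|%:Z - 2 - j))^T
    *m (dual_mx i)^T.
Proof.
apply/matrixP=> g f; rewrite mul_tr_dual_mx mul_dual_mx !mxE !enum_val_dual_ord.
have fV := enum_valP f; have gV := enum_valP g.
rewrite !faces_relative_dual // in fV gV.
case/andP: fV => fV _; case/andP: gV => gV _.
rewrite [X in _ = X * _]mulrC [RHS]mulrC mulrA.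
rewrite -(@incidence_setD (V :\: enum_val g) (V :\: enum_val f)) ?subsetDl //.
by rewrite !setDDr !setDv !set0U (setIidPr fV) (setIidPr gV).
Qed.

Lemma laplacian_relative_dual i :
  laplacian R (relative_dual V Phi) i
  = dual_mx i *m laplacian R Phi (#|V|%:Z - 2 - i) *m (dual_mx i)^T.
Proof.
rewrite /laplacian.
(* The degrees above and below [i] trade places, so duality swaps the two summands of the
   Laplacian. *)
have -> : #|V|%:Z - 2 - i + 1 = #|V|%:Z - 2 - (i - 1) by ring.
have -> : #|V|%:Z - 2 - i - 1 = #|V|%:Z - 2 - (i + 1) by ring.
rewrite !boundary_relative_dual !trmx_mul !trmxK !mulmxA.
rewrite -!(mulmxA _ (dual_mx _)^T (dual_mx _)) !tr_dual_mxK !mulmx1.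
by rewrite mulmxDr mulmxDl !mulmxA addrC.
Qed.

Lemma spectrum_relative_dual i :
  spectrum R (relative_dual V Phi) i = spectrum R Phi (#|V|%:Z - 2 - i).
Proof.
rewrite /spectrum laplacian_relative_dual char_poly_orthogonal_conj //.
- exact: card_faces_relative_dual.
- exact: dual_mx_trK.
Qed.

End DualLaplacian.

(** * Generating polynomials and recursions on their coefficients *)

Lemma coef_sum_XnC (A : nzRingType) n (c : nat -> A) k :
  (\sum_(i < n) 'X^i * (c i)%:P)`_k = if (k < n)%N then c k else 0.
Proof.
rewrite -coef_poly poly_def; congr (coefp k _); apply: eq_bigr => i _.
by rewrite -mul_polyC commr_polyXn.
Qed.

(* [s] is indexed by dimension, hence the shift.  The ring is abstract because
   unification against the instances of [qsums R] does not terminate in practice. *)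
Definition gen_poly (A : nzRingType) n (s : int -> A) : {poly A} :=
  \sum_(i < n.+1) 'X^i * (s (i%:Z - 1))%:P.

(** Degrees 0 to [n] of [gen_poly] record the dimensions -1 to [n - 1], so its coefficients
    determine a supported [s]. *)
Definition supported (A : nzRingType) (n : nat) (s : int -> A) :=
  forall i, i < -1 \/ n%:Z <= i -> s i = 0.

Lemma coef_gen_poly (A : nzRingType) n (s : int -> A) k : supported n s ->
  (gen_poly n s)`_k = s (k%:Z - 1).
Proof.
move=> s0; rewrite /gen_poly (coef_sum_XnC _ (fun k => s (k%:Z - 1))).
by case: ltnP => // nk; rewrite s0 //; right; lia.
Qed.

(** Multiplication by ['X] shifts [s2] by one. The coefficient identity ranges over all integers so
    that it can be reversed freely. *)
Lemma gen_poly_recursionP (A : nzRingType) n (q : A) (s s1 s2 s3 : int -> A) :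
    supported n s -> supported n s1 -> supported n s2 -> supported n s3 ->
  gen_poly n s = q%:P * gen_poly n s1 + q%:P * 'X * gen_poly n s2
                 + (1 - q%:P) * gen_poly n s3 <->
  forall i, s i = q * s1 i + q * s2 (i - 1) + (1 - q) * s3 i.
Proof.
move=> sn s1n s2n s3n.
have coefE k : (q%:P * gen_poly n s1 + q%:P * 'X * gen_poly n s2
                + (1 - q%:P) * gen_poly n s3)`_k
    = q * s1 (k%:Z - 1) + q * s2 (k%:Z - 1 - 1) + (1 - q) * s3 (k%:Z - 1).
  rewrite -mulrA -polyC1 -polyCB !coefD !coefCM coefXM !coef_gen_poly //.
  (* In degree 0 the factor ['X] gives coefficient 0, which agrees with [s2 (-2) = 0]. *)
  congr (_ + _ * _ + _); case: k => [|k] /=; first by rewrite s2n //; left.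
  by congr s2; lia.
split=> [rec i|rec]; last first.
  by apply/polyP=> k; rewrite coefE coef_gen_poly.
(* Dimensions below -1 match no coefficient; there both sides vanish by support. *)
have [i1|i1] := leP (-1) i; last first.
  rewrite sn ?s1n ?s2n ?s3n ?mulr0 ?addr0 //; left; lia.
have -> : i = (absz (i + 1))%:Z - 1 by lia.
by rewrite -coefE -rec coef_gen_poly.
Qed.

(** Here [r1 i] is [s2 (n - i - 1)] and [r2 (i - 1)] is [s1 (n - i)], so the first two terms of the
    recursion at [n - i] change places. *)
Lemma reversed_recursion (A : nzRingType) (n : int) (q : A)
    (s s1 s2 s3 r r1 r2 r3 : int -> A) :
    (forall i, r i = s (n - i)) -> (forall i, r1 i = s2 (n - 1 - i)) ->
    (forall i, r2 i = s1 (n - 1 - i)) -> (forall i, r3 i = s3 (n - i)) ->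
    (forall i, s i = q * s1 i + q * s2 (i - 1) + (1 - q) * s3 i) ->
  forall i, r i = q * r1 i + q * r2 (i - 1) + (1 - q) * r3 i.
Proof.
move=> rE r1E r2E r3E sE i; rewrite rE r1E r2E r3E sE.
have -> : n - 1 - i = n - i - 1 by ring.
have -> : n - 1 - (i - 1) = n - i by ring.
by rewrite [q * s1 _ + _]addrC.
Qed.

(** * The recursion for spectra and its invariance under duality *)

Section Recursion.
Variables (R : rcfType) (d : Order.disp_t) (E : finOrderType d).
Implicit Types (Phi : {set {set E}}) (i : int) (e : E).

Definition spectrum_sum Phi i : qsums R := \sum_(x <- spectrum R Phi i) qpow x.

Lemma spectrum_sum_supported Phi : supported #|E| (spectrum_sum Phi).
Proof.
move=> i ilim; rewrite /spectrum_sum.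
suff -> : spectrum R Phi i = [::] by rewrite big_nil.
have f0 : #|faces Phi i| = 0%N.
  apply/eqP; rewrite cards_eq0 -subset0; apply/subsetP=> F.
  rewrite inE /Defs.dim => /andP[_ /eqP iE].
  have FE : (#|F| <= #|E|)%N by apply: max_card.
  by case: ilim; lia.
rewrite /spectrum.
(* Without faces the Laplacian is a 0 by 0 matrix, so its characteristic polynomial is 1 and has no
   roots. *)
have -> : char_poly (laplacian R Phi i) = 1.
  move: (laplacian R Phi i); rewrite f0 => A; exact: det_mx00.
by rewrite rootsRC.
Qed.

Lemma spectral_recursionP Phi e :
  spectral_recursion R Phi e <->
  forall i, spectrum_sum Phi i
    = qpow 1 * spectrum_sum (deletion Phi e) i
      + qpow 1 * spectrum_sum (contraction Phi e) (i - 1)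
      + (1 - qpow 1) * spectrum_sum (reduction Phi e) i.
Proof. by apply: gen_poly_recursionP; apply: spectrum_sum_supported. Qed.

Lemma spectrum_sum_relative_dual (V : {set E}) Phi i : Phi \subset powerset V ->
  spectrum_sum (relative_dual V Phi) i = spectrum_sum Phi (#|V|%:Z - 2 - i).
Proof. by move=> PhiV; rewrite /spectrum_sum spectrum_relative_dual. Qed.

Lemma spectral_recursion_dual Phi e :
  spectral_recursion R Phi e -> spectral_recursion R (dual Phi) e.
Proof.
(* Dual dimensions add up to [#|E| - 2] in the full ground set and to one less once [e] is
   removed. *)
rewrite !spectral_recursionP; apply: (@reversed_recursion _ (#|E|%:Z - 2)) => i.
- by rewrite dualE spectrum_sum_relative_dual ?sub_powersetT // cardsT.
- rewrite deletion_dual spectrum_sum_relative_dual ?contraction_sub //.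
  by congr (spectrum_sum _ _); rewrite card_setTD1; ring.
- rewrite contraction_dual spectrum_sum_relative_dual ?deletion_sub //.
  by congr (spectrum_sum _ _); rewrite card_setTD1; ring.
by rewrite reduction_dual dualE spectrum_sum_relative_dual ?sub_powersetT // cardsT.
Qed.

End Recursion.

Theorem proposition3p7 (R : realType) (d : Order.disp_t) (E : finOrderType d)
    (Phi : {set {set E}}) (e : E) (Phi_interval : is_interval Phi)
    (Phi_rec : spectral_recursion R Phi e) :
  spectral_recursion R (dual Phi) e.
Proof. exact: spectral_recursion_dual. Qed.
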